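(* Let $p\in(0,1]$. Suppose that $(\mathcal{M},d)$ is infinite and is either (a) a metric space, or (b) a $p$-metric space containing $\operatorname{dens}\mathcal{M}$-many isolated points. Then for every $C>2^{1/p}$, $\ell_{p}(\operatorname{dens}\mathcal{M})$ is $C$-complemented in $\mathcal{F}_{p}(\mathcal{M})$.
   Context: Let $0<p\le 1$. A $p$-metric on a set $\mathcal{M}$ is a symmetric map $d\colon\mathcal{M}\times\mathcal{M}\to[0,\infty)$ with $d(x,y)=0$ iff $x=y$ and $d^p(x,y)\le d^p(x,z)+d^p(z,y)$ for all $x,y,z$ (every metric is a $p$-metric). A $p$-Banach space is a complete real vector space with a $p$-norm, i.e. a quasi-norm with $\|x+y\|^p\le\|x\|^p+\|y\|^p$. For a $p$-metric space $\mathcal{M}$ with base point $0$, the Lipschitz free $p$-space $\mathcal{F}_p(\mathcal{M})$ is the $p$-Banach space, unique up to linear isometry, with an isometric embedding $\delta_{\mathcal{M}}\colon\mathcal{M}\to\mathcal{F}_p(\mathcal{M})$, $\delta_{\mathcal{M}}(0)=0$, such that for every $p$-Banach space $X$ and every Lipschitz map $f\colon\mathcal{M}\to X$ with $f(0)=0$ there is a unique bounded linear map $T_f\colon\mathcal{F}_p(\mathcal{M})\to X$ with $T_f\circ\delta_{\mathcal{M}}=f$, and $\|T_f\|=\mathrm{Lip}(f)$. The linear span of $\delta_{\mathcal{M}}(\mathcal{M})$ is dense in $\mathcal{F}_p(\mathcal{M})$. Changing the base point yields a linearly isometric space. $\operatorname{dens}\mathcal{M}$ is the density character, i.e. the minimal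 cardinality of a dense subset of $\mathcal{M}$. For a cardinal (or set) $\kappa$, $\ell_p(\kappa)$ is the space of real families $(a_i)_{i\in\kappa}$ with $p$-norm $(\sum_i|a_i|^p)^{1/p}<\infty$. A space $Y$ is $C$-complemented in $X$ if there are bounded linear maps $S\colon Y\to X$ and $P\colon X\to Y$ with $P\circ S=\mathrm{Id}_Y$ and $\|S\|\,\|P\|\le C$. A point $x$ is isolated if $d(x,\mathcal{M}\setminus\{x\})>0$. *)

(* Defs.v *)
From HB Require Import structures.
From mathcomp Require Import all_boot all_order all_algebra.
From mathcomp Require Import all_classical all_reals all_analysis.

Set Implicit Arguments.
Unset Strict Implicit.
Unset Printing Implicit Defensive.
Import Order.TTheory GRing.Theory Num.Theory.
Import numFieldNormedType.Exports.

Local Open Scope classical_set_scope.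
Local Open Scope card_scope.
Local Open Scope ring_scope.

Lemma min_card (M : Type) (x0 : M) (E : set (set M)) : E !=set0 ->
  exists2 D, E D & forall D', E D' -> D #<= D'.
Proof.
move=> [D0 ED0].
pose P (F : set (set M -> M)) :=
  (forall f D, F f -> E D -> D (f D)) /\
  (forall f g D, F f -> F g -> E D -> f D = g D -> f = g).
have [|F [[FE Finj] Fmax]] := @Zorn_bigcup _ P.
  move=> G GP Gtot; split=> [f D [A GA Af]|f g D [A GA Af] [B GB Bg]].
    exact: (GP A GA).1.
  have [AB|BA] := Gtot _ _ GA GB.
  - by apply: (GP B GB).2 => //; exact: AB.
  - by apply: (GP A GA).2 => //; exact: BA.
have [[D ED DF]|noD] :=
    pselect (exists2 D, E D & D `<=` (fun f => f D) @` F).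
  exists D => // D' ED'.
  apply: card_le_trans (subset_card_le DF) _.
  apply: card_le_trans (card_image_le _ _) _.
  have Finj' : {in F &, injective (fun f => f D')}.
    by move=> f g /set_mem Ff /set_mem Fg; exact: Finj.
  have /card_eqPle[_ FD'] := inj_card_eq Finj'.
  apply: card_le_trans FD' _.
  apply: subset_card_le => _ [f Ff <-].
  exact: (FE f D').
have new D : exists y, E D -> D y /\ forall f, F f -> f D <> y.
  have [ED|nED] := pselect (E D); last by exists x0.
  have /existsNP[y /not_implyP[Dy Fy]] : ~ (D `<=` (fun f => f D) @` F).
    by move=> DF; apply: noD; exists D.
  by exists y => _; split=> // f Ff fy; apply: Fy; exists f.
have {new}[h hP] := choice new.
have hF : ~ F h by move=> Fh; exact: ((hP _ ED0).2 _ Fh).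
exfalso; apply: (Fmax (F `|` [set h])).
  by split=> [f Ff|Fh]; [left|apply: hF; apply: Fh; right].
split=> [f D [Ff|->] ED|f g D [Ff|->] [Fg|->] ED//].
- exact: (FE f D).
- exact: (hP _ ED).1.
- exact: Finj.
- by move/((hP _ ED).2 _ Ff).
- by move/esym/((hP _ ED).2 _ Fg).
Qed.

(** ** Metrics and p-metrics *)

Section metrics.
Context {R : realType} {M : Type}.
Implicit Types (p : R) (d : M -> M -> R).

Definition is_pmetric p d :=
  [/\ forall x y, 0 <= d x y,
      forall x y, d x y = 0 <-> x = y,
      forall x y, d x y = d y x &
      forall x y z, d x y `^ p <= d x z `^ p + d z y `^ p].

Definition is_metric d :=
  [/\ forall x y, 0 <= d x y,
      forall x y, d x y = 0 <-> x = y,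
      forall x y, d x y = d y x &
      forall x y z, d x y <= d x z + d z y].

Definition dense_for d (D : set M) :=
  forall x e, 0 < e -> exists2 y, D y & d x y < e.

(* "#|I| = dens (M, d)"; cardinals are represented by types. *)
Definition has_card_dens d (I : Type) :=
  (exists2 D : set M, dense_for d D & [set: I] #= D) /\
  (forall D : set M, dense_for d D -> [set: I] #<= D).

Lemma has_card_dens_exists p d : is_metric d \/ is_pmetric p d ->
  M -> exists D : set M, has_card_dens d D.
Proof.
move=> dP x0; have [|D dD Dmin] := min_card x0 (E := dense_for d).
  exists setT => x e e0; exists x => //; rewrite (_ : d x x = 0)//.
  by case: dP => -[_ d0 _ _]; apply/d0.
exists D; split=> [|D' dD']; first by exists D; last exact: card_setT.
have /card_eqPle[DD _] := card_setT D.
exact: card_le_trans DD (Dmin D' dD').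
Qed.

(* The distance to the empty set is +oo, hence the extended reals. *)
Definition isolated_for d (x : M) :=
  (0 < ereal_inf [set (d x y)%:E | y in ~` [set x]])%E.

End metrics.

(** ** p-Banach spaces *)

HB.mixin Record isPNormed (R : realType) (p : R) X of GRing.Lmodule R X := {
  pnorm : X -> R ;
  pnorm_ge0 : forall x, 0 <= pnorm x ;
  pnorm0_eq0 : forall x, pnorm x = 0 -> x = 0 ;
  pnormZ : forall (a : R) x, pnorm (a *: x) = `|a| * pnorm x ;
  ler_pnormD : forall x y, pnorm (x + y) `^ p <= pnorm x `^ p + pnorm y `^ p
}.

#[short(type="pNormedType")]
HB.structure Definition PNormed (R : realType) (p : R) :=
  {X of isPNormed R p X & GRing.Lmodule R X}.

Arguments pnorm {R p s} x : rename.

HB.mixin Record PNormed_isComplete (R : realType) (p : R) X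
    of PNormed R p X := {
  pnorm_complete : forall u : nat -> X,
    (forall e, 0 < e -> \forall m & n \near \oo, pnorm (u m - u n) < e) ->
    exists l : X, pnorm (u n - l) @[n --> \oo] --> (0 : R)
}.

#[short(type="pBanachType")]
HB.structure Definition PBanach (R : realType) (p : R) :=
  {X of PNormed R p X & PNormed_isComplete R p X}.

(* A p-norm is in particular a quasi-norm. *)
Lemma pnorm_quasi (R : realType) (p : R) (X : pNormedType p) : 0 < p ->
  exists K : R, forall x y : X, pnorm (x + y) <= K * (pnorm x + pnorm y).
Proof.
move=> p0; exists (2 `^ p^-1) => x y.
have N0 := @pnorm_ge0 R p X.
have S0 : 0 <= pnorm x + pnorm y by rewrite addr_ge0.
have root c : 0 <= c -> c = (c `^ p) `^ p^-1.
  by move=> c0; rewrite -powRrM mulfV ?gt_eqF// powRr1.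
rewrite [leLHS]root// [X in _ * X]root// -powRM ?powR_ge0//.
rewrite ge0_ler_powR ?invr_ge0 ?nnegrE ?mulr_ge0 ?powR_ge0 ?(ltW p0)//.
rewrite (le_trans (ler_pnormD _ _))// mulr_natl mulr2n.
by rewrite lerD// ge0_ler_powR ?nnegrE ?(ltW p0)// ?lerDl ?lerDr.
Qed.

Section operators.
Context {R : realType} {p : R}.

Definition bounded_op (X Y : pNormedType p) (T : X -> Y) :=
  exists K : R, forall x, pnorm (T x) <= K * pnorm x.

Definition opnorm (X Y : pNormedType p) (T : X -> Y) : R :=
  sup [set pnorm (T x) | x in [set x | pnorm x <= 1]].

Definition complemented (C : R) (Y X : pNormedType p) :=
  exists (S : {linear Y -> X}) (P : {linear X -> Y}),
    [/\ bounded_op S, bounded_op P, cancel S P & opnorm S * opnorm P <= C].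

Definition lipschitz_for (M : Type) (d : M -> M -> R) (X : pNormedType p)
    (f : M -> X) :=
  exists K : R, forall x y, pnorm (f x - f y) <= K * d x y.

Definition lip_const (M : Type) (d : M -> M -> R) (X : pNormedType p)
    (f : M -> X) : R :=
  sup [set r | exists x y, x <> y /\ r = pnorm (f x - f y) / d x y].

(* (F, delta) is a Lipschitz free p-space over (M, d) with base point x0. *)
Definition is_lipschitz_free (M : Type) (d : M -> M -> R) (x0 : M)
    (F : pBanachType p) (delta : M -> F) :=
  [/\ forall x y, pnorm (delta x - delta y) = d x y,
      delta x0 = 0 &
      forall (X : pBanachType p) (f : M -> X), lipschitz_for d f -> f x0 = 0 ->
        exists T : {linear F -> X},
          [/\ bounded_op T,
              forall x, T (delta x) = f x,
              opnorm T = lip_const d f &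
              forall T' : {linear F -> X}, bounded_op T' ->
                (forall x, T' (delta x) = f x) -> T' =1 T]].

End operators.

(** ** The spaces l_p(I) *)

Lemma ler_powRD (R : realType) (p a b : R) : 0 < p <= 1 -> 0 <= a -> 0 <= b ->
  (a + b) `^ p <= a `^ p + b `^ p.
Proof.
move=> /andP[p0 p1]; rewrite le_eqVlt => /predU1P[<- b0|a0].
  by rewrite add0r lerDr powR_ge0.
rewrite le_eqVlt => /predU1P[<-|b0]; first by rewrite addr0 lerDl powR_ge0.
have s0 : 0 < a + b by rewrite addr_gt0.
have aux c : 0 < c -> c <= a + b -> c / (a + b) * (a + b) `^ p <= c `^ p.
  move=> c0 cs; rewrite -[in leRHS](divfK (lt0r_neq0 s0) c).
  rewrite [leRHS]powRM ?(ltW s0) ?(ltW (divr_gt0 _ _))// ler_wpM2r ?powR_ge0//.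
  by rewrite ger1_powR// divr_gt0//= ler_pdivrMr// mul1r.
rewrite -[leLHS]mul1r -(divff (lt0r_neq0 s0)) mulrDl mulrDl.
by rewrite lerD// aux// ?lerDl ?lerDr ltW.
Qed.

Section lp.
Context {R : realType} (p : R) (hp : 0 < p <= 1) (I : choiceType).
Implicit Types a b : I -> R.

Definition lp_sum a : \bar R := (\esum_(i in [set: I]) (`|a i| `^ p)%:E)%E.

Definition lp_pred of 0 < p <= 1 : {pred I -> R} :=
  fun a => (lp_sum a < +oo)%E.

Let p_gt0 : 0 < p. Proof. by case/andP: hp. Qed.

Let lp_sum_ge0 a : (0 <= lp_sum a)%E.
Proof. by apply: esum_ge0 => i _; rewrite lee_fin powR_ge0. Qed.

Let lp_sum0 : lp_sum 0 = 0%E.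
Proof. by apply: esum1 => i _; rewrite normr0 powR0 ?gt_eqF. Qed.

Let lp_sumD a b : (lp_sum (a + b)%R <= lp_sum a + lp_sum b)%E.
Proof.
rewrite -esumD; [|by move=> *; rewrite lee_fin powR_ge0..].
apply: le_esum => i _; rewrite -EFinD lee_fin.
apply: le_trans (ler_powRD hp (normr_ge0 _) (normr_ge0 _)).
by rewrite ge0_ler_powR ?nnegrE ?addr_ge0 ?(ltW p_gt0)// ler_normD.
Qed.

Let lp_sumZ_le (c : R) a : (lp_sum (c *: a)%R <= (`|c| `^ p)%:E * lp_sum a)%E.
Proof.
apply: ge_ereal_sup => _ [A [finA _] <-].
rewrite fsbig_finite//=.
under eq_bigr do rewrite normrM powRM// EFinM.
rewrite -ge0_sume_distrr; last by move=> i _; rewrite lee_fin powR_ge0.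
rewrite lee_wpmul2l ?lee_fin ?powR_ge0//.
by rewrite -fsbig_finite//; apply: ereal_sup_ubound; exists A.
Qed.

Let lp_sumZ (c : R) a : lp_sum (c *: a) = ((`|c| `^ p)%:E * lp_sum a)%E.
Proof.
have [->|c0] := eqVneq c 0.
  by rewrite scale0r lp_sum0 normr0 powR0 ?gt_eqF// mul0e.
apply/eqP; rewrite eq_le lp_sumZ_le/=.
have := lp_sumZ_le c^-1 (c *: a); rewrite scalerA mulVf// scale1r => h.
have k0 : 0 < `|c| `^ p by rewrite powR_gt0// normr_gt0.
apply: le_trans (lee_wpmul2l _ h) _; first by rewrite lee_fin ltW.
rewrite muleA -EFinM -powRM// -normrM divff// normr1.
by rewrite powR1 mul1e.
Qed.

Lemma lp_submod : submod_closed (lp_pred hp).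
Proof.
split=> [|c a b a_fin b_fin]; rewrite unfold_in; first by rewrite lp_sum0 ltry.
apply: le_lt_trans (lp_sumD _ _) _; rewrite lp_sumZ lte_add_pinfty//.
by rewrite lte_mul_pinfty// lee_fin powR_ge0.
Qed.

HB.instance Definition _ :=
  GRing.isSubmodClosed.Build R (I -> R) (lp_pred hp) lp_submod.

Record lp : Type := Lp { lp_fun :> I -> R ; _ : lp_fun \in lp_pred hp }.

HB.instance Definition _ := [isSub for lp_fun].
HB.instance Definition _ := [Choice of lp by <:].
HB.instance Definition _ := [SubChoice_isSubLmodule of lp by <:].

Definition lp_norm (a : lp) : R := fine (lp_sum a) `^ p^-1.

Let lp_sum_fin (a : lp) : lp_sum a \is a fin_num.
Proof. by rewrite ge0_fin_numE//; exact: (valP a). Qed.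

Let lp_normX (a : lp) : lp_norm a `^ p = fine (lp_sum a).
Proof. by rewrite /lp_norm -powRrM mulVf ?gt_eqF// powRr1// fine_ge0. Qed.

Let lp_norm_ge0 (a : lp) : 0 <= lp_norm a. Proof. exact: powR_ge0. Qed.

Let lp_norm0_eq0 (a : lp) : lp_norm a = 0 -> a = 0.
Proof.
move=> a0; apply/val_inj/funext => i /=.
have : lp_sum a = 0%E by rewrite -[LHS]fineK// -lp_normX a0 powR0 ?gt_eqF.
move=> s0; have : ((`|a i| `^ p)%:E <= lp_sum a)%E.
  rewrite -(@esum_set1 _ _ i (fun j => (`|a j| `^ p)%:E)) ?lee_fin ?powR_ge0//.
  by apply: esum_ge; exists [set i]; rewrite ?esum_set1 ?fsbig_set1 ?lee_fin ?powR_ge0.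
rewrite s0 lee_fin => h; apply/normr0_eq0/(@powR_eq0_eq0 _ _ p).
by apply/eqP; rewrite eq_le h powR_ge0.
Qed.

Let lp_normZ (c : R) (a : lp) : lp_norm (c *: a) = `|c| * lp_norm a.
Proof.
rewrite /lp_norm [lp_sum _]lp_sumZ fineM// powRM ?powR_ge0 ?fine_ge0//.
by rewrite -powRrM divff ?gt_eqF// powRr1.
Qed.

Let ler_lp_normD (a b : lp) :
  lp_norm (a + b) `^ p <= lp_norm a `^ p + lp_norm b `^ p.
Proof.
have aux (x y z : R) (s t u : \bar R) : x = fine s -> y = fine t ->
    z = fine u -> s \is a fin_num -> t \is a fin_num -> u \is a fin_num ->
    (s <= t + u)%E -> x <= y + z.
  by move=> -> -> -> sf tf uf; rewrite -lee_fin EFinD !fineK.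
exact: (aux _ _ _ _ _ _ (lp_normX (a + b)) (lp_normX a) (lp_normX b)
  (lp_sum_fin _) (lp_sum_fin _) (lp_sum_fin _)
  (lp_sumD (lp_fun a) (lp_fun b))).
Qed.

HB.instance Definition _ := isPNormed.Build R p lp
  lp_norm_ge0 lp_norm0_eq0 lp_normZ ler_lp_normD.

End lp.

(* Main.v *)
Require Import Defs.
From HB Require Import structures.
From mathcomp Require Import all_boot all_order all_algebra.
From mathcomp Require Import finmap.
From mathcomp Require Import all_classical all_reals all_analysis.
From mathcomp Require Import lra.

(** A family of molecules [m i = (delta (x i) - delta (y i)) / r i] spans a copy
    of [l_p(I)] in the free space as soon as it is bounded: a [p]-norm makes
    [a |-> sum_i a i *: m i] bounded on [l_p(I)] (section [synthesis]). A
    projection onto this copy is the same as a Lipschitz map from [M] to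
    [l_p(I)], by the universal property; the latter requires [l_p(I)] to be
    complete (lemma [lp_complete]). Such a map is [z |-> (u i z)_i] for a family
    of disjointly supported 1-Lipschitz bumps with [u i (x i) = r i] and with
    every [y j] outside all the supports. Disjointness makes its Lipschitz
    constant at most [2 `^ p^-1] (lemma [bump_map_lip]), and the molecules have
    norm at most [c] if [d (x i) (y i) <= c * r i]. Since [c > 1] is arbitrary,
    the theorem reduces to finding [dens M] many such pairs and bumps
    (lemma [exists_bumps]).

    At an isolated point [x], the bump is supported by [x] alone and [y] is an
    almost nearest point. It may be the centre of another bump, so only a
    subset of the isolated points that avoids its image under [x |-> y] is kept;
    one of full cardinality exists (lemma [card_free_subset]). This settles the
    case of a [p]-metric space.

    In a metric space, [z |-> max 0 (r - d x z)] is a 1-Lipschitz bump around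
    any point [x], and at a non-isolated [x] the point [y] can be taken at
    distance exactly [r] for arbitrarily small [r]. A discrete set of
    non-isolated points therefore provides bumps in disjoint balls, each
    containing its own [y]. What remains is that a metric space contains a
    discrete subset of cardinality [dens M] (lemma [exists_discrete_dense]),
    including when [dens M] is singular; an infinite set that is split in two
    has a part of full cardinality (lemma [infinite_card_setU]), which is
    applied to the isolated and the non-isolated points of this discrete set. *)

Set Implicit Arguments.
Unset Strict Implicit.
Unset Printing Implicit Defensive.
Import Order.TTheory GRing.Theory Num.Theory.
Import numFieldNormedType.Exports.

Local Open Scope classical_set_scope.
Local Open Scope card_scope.
Local Open Scope ring_scope.

(** * Cardinal arithmetic *)

Lemma card_le_fun T U (u0 : U) (A : set T) (B : set U) : A #<= B ->
  exists f : T -> U, (forall x, A x -> B (f x)) /\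
    (forall x y, A x -> A y -> f x = f y -> x = y).
Proof.
move=> /card_leP[f0].
have /injfunPex[f fAB finj] : $|{injfun A >-> B}| by squash (valLR u0 f0).
exists f; split=> [x Ax|x y Ax Ay]; first exact: fAB.
by apply: finj; rewrite inE.
Qed.

Lemma fun_card_le T U (f : T -> U) (A : set T) (B : set U) :
  (forall x, A x -> B (f x)) ->
  (forall x y, A x -> A y -> f x = f y -> x = y) -> A #<= B.
Proof.
move=> fAB finj.
have /injfunPex[g] : exists2 f : T -> U, set_fun A B f & set_inj A f.
  by exists f => // x y /set_mem Ax /set_mem Ay; exact: finj.
exact: inj_card_le.
Qed.

Lemma card_le_total T (A B : set T) : A #<= B \/ B #<= A.
Proof.
have [->|/set0P[x0 _]] := eqVneq A set0; first by left.
have [|D [->|->] DP] := min_card x0 (E := [set A; B]).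
- by exists A; left.
- by left; apply: DP; right.
- by right; apply: DP; left.
Qed.

(** A maximal disjoint family [F] of injective sequences in [A] covers [A] up to
    a finite set, which is absorbed by one of the sequences: this gives
    [A <= F * nat], hence [A * nat <= F * nat * nat <= F * nat <= A]. *)
Lemma infinite_card_mul_nat T (A : set T) : infinite_set A ->
  A `*` [set: nat] #<= A.
Proof.
move=> infA; have [t0 _] := infinite_setN0 infA.
pose P (F : set (nat -> T)) :=
  (forall f, F f -> (forall n, A (f n)) /\ injective f) /\
  (forall f g m n, F f -> F g -> f m = g n -> f = g).
have [|F [[FA Fdisj] Fmax]] := @Zorn_bigcup _ P.
  move=> G GP Gtot; split=> [f [D GD Df]|f g m n [D GD Df] [D' GD' D'g]].
    exact: (GP D GD).1.
  have [DD'|D'D] := Gtot _ _ GD GD'.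
  - by apply: (GP D' GD').2 => //; exact: DD'.
  - by apply: (GP D GD).2 => //; exact: D'D.
pose Q := A `\` [set f n | f in F & n in [set: nat]].
have finQ : finite_set Q.
  apply: contrapT => /infiniteP /(card_le_fun t0)[f [fQ finj]].
  have nFf : ~ F f by move=> Ff; apply: (fQ 0%N I).2; exists f => //; exists 0%N.
  apply: (Fmax (F `|` [set f])).
    by split=> [g Fg|Fh]; [left|apply: nFf; apply: Fh; right].
  split=> [g [Fg|->]|g h m n [Fg|->] [Fh|->]//].
  - exact: FA.
  - by split=> [n|m n]; [case: (fQ n I)|exact: finj].
  - exact: Fdisj.
  - by move=> e; case: (fQ n I).2; rewrite -e; exists g => //; exists m.
  - by move=> e; case: (fQ m I).2; rewrite e; exists h => //; exists n.
have [f0 Ff0] : F !=set0.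
  apply/set0P/eqP => F0; apply: infA; apply: sub_finite_set finQ => x Ax.
  by split=> // -[f]; rewrite F0.
(* The finite remainder [Q] is numbered by [c] together with the terms of [f0];
   the other sequences keep their own numbering. *)
pose C := Q `|` range f0.
have : countable C.
  have -> : C = \bigcup_(b in [set: bool]) (if b then Q else range f0).
    by apply/seteqP; split=> [x [Qx|fx]|x [[] _ ?]];
      [exists true|exists false|left|right].
  apply: bigcup_countable => // -[] _; first exact: finite_set_countable.
  by apply: card_le_trans (card_image_le _ _) _; exact: card_lexx.
move=> /countable_injP[c cinj].
have /choice[code codeP] : forall x, exists fn : (nat -> T) * nat, A x ->
    [/\ F fn.1, C x -> fn = (f0, c x) &
        ~ C x -> fn.1 <> f0 /\ fn.1 fn.2 = x].
  move=> x; have [Cx|nCx] := pselect (C x); first by exists (f0, c x).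
  have [Ax|nAx] := pselect (A x); last by exists (f0, 0%N).
  have [[f Ff [n _ fn]]|nex] :=
      pselect ([set f n | f in F & n in [set: nat]] x).
    exists (f, n); split=> // _; split=> //= ff0; apply: nCx; right.
    by exists n; rewrite // -ff0.
  by case: nCx; left.
apply: (@fun_card_le _ _
  (fun z : T * nat => (code z.1).1 (choice.pickle ((code z.1).2, z.2)))).
  by move=> [x k] [/= Ax _]; have [/FA[]] := codeP x Ax.
move=> [x k] [y l] [/= Ax _] [/= Ay _].
have [Fx Cx nCx] := codeP x Ax; have [Fy Cy nCy] := codeP y Ay.
move=> e; have e1 := Fdisj _ _ _ _ Fx Fy e; move: e; rewrite e1.
move=> /(FA _ Fy).2 /(pcan_inj choice.pickleK)[e2 ->]; congr pair.
have [xC|xC] := pselect (C x); have [yC|yC] := pselect (C y).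
- by move: e2; rewrite Cx// Cy// => /=; apply: cinj; rewrite inE.
- by have [] := nCy yC; rewrite -e1 Cx.
- by have [] := nCx xC; rewrite e1 Cy.
- by have [_ <-] := nCx xC; have [_ <-] := nCy yC; rewrite e1 e2.
Qed.

Lemma card_bigcup_nat_le T U (E : nat -> set T) (B : set U) :
  (forall n, E n #<= B) -> \bigcup_n E n #<= B `*` [set: nat].
Proof.
have [->|/set0P[u0 Bu0]] := eqVneq B set0.
  move=> EB; suff -> : \bigcup_n E n = set0 by [].
  by apply/seteqP; split=> // x [n _]; have /card_le0P-> := EB n.
move=> EB; have [f fP] := choice (fun n => card_le_fun u0 (EB n)).
have /choice[k kP] : forall x, exists n, (\bigcup_n E n) x -> E n x.
  move=> x; have [[n _ Ex]|nex] := pselect ((\bigcup_n E n) x).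
    by exists n.
  by exists 0%N.
apply: (@fun_card_le _ _ (fun x => (f (k x) x, k x))) => [x /kP Ex|].
  by split=> //; exact: (fP _).1.
by move=> x y /kP Ex /kP Ey [] + e; rewrite -e in Ey *; exact: (fP _).2.
Qed.

(** The larger of [A] and [B] is infinite, so it absorbs the union. *)
Lemma infinite_card_setU T S (X : set S) (A B : set T) : infinite_set X ->
  X #<= A `|` B -> X #<= A \/ X #<= B.
Proof.
move=> infX; wlog AB : A B / A #<= B.
  by move=> wl; have [|BA] := card_le_total A B; [exact: wl|
    by rewrite setUC => /(wl _ _ BA)[]; [right|left]].
move=> XAB; right; have infB : infinite_set B.
  move=> finB; apply: infX; apply: card_le_finite XAB _.
  by rewrite finite_setU; split=> //; exact: card_le_finite AB finB.
apply: card_le_trans XAB (card_le_trans _ (infinite_card_mul_nat infB)).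
have -> : A `|` B = \bigcup_n (if n is 0%N then A else B).
  apply/seteqP; split=> [x [Ax|Bx]|x [[|n] _ ?]];
    [by exists 0%N|by exists 1%N|by left|by right].
by apply: card_bigcup_nat_le => -[|n] //; exact: card_lexx.
Qed.

(** * Discrete subsets of metric spaces *)

(** Gluing the injections costs nothing when the targets are disjoint; the
    sources may overlap. *)
Lemma card_bigcup_le T U (J : Type) (P : set J) (E : J -> set T)
    (D : J -> set U) : (forall j, P j -> E j #<= D j) ->
  (forall i j x, P i -> P j -> D i x -> D j x -> i = j) ->
  \bigcup_(j in P) E j #<= \bigcup_(j in P) D j.
Proof.
move=> ED Ddisj; have [->//|/set0P[t0 [j0 Pj0 Et0]]] :=
  eqVneq (\bigcup_(j in P) E j) set0.
have [u0 Du0] : D j0 !=set0.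
  apply/set0P/eqP => D0; have /card_le0P E0 : E j0 #<= @set0 U.
    by rewrite -D0; exact: ED.
  by rewrite E0 in Et0.
have /choice[f fP] : forall j, exists f : T -> U, P j ->
    (forall x, E j x -> D j (f x)) /\
    (forall x y, E j x -> E j y -> f x = f y -> x = y).
  move=> j; have [Pj|nPj] := pselect (P j); last by exists (fun=> u0).
  by have [f fP] := card_le_fun u0 (ED j Pj); exists f.
have /choice[k kP] : forall x, exists j, (\bigcup_(j in P) E j) x -> P j /\ E j x.
  move=> x; have [[j Pj Ex]|nex] := pselect ((\bigcup_(j in P) E j) x).
    by exists j.
  by exists j0.
apply: (@fun_card_le _ _ (fun x => f (k x) x)) => [x /kP[Pk Ex]|].
  by exists (k x) => //; exact: (fP _ Pk).1.
move=> x y /kP[Pkx Ex] /kP[Pky Ey] e.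
have Dx := (fP _ Pkx).1 _ Ex; have Dy := (fP _ Pky).1 _ Ey.
rewrite -e in Dy; have kxy := Ddisj _ _ _ Pkx Pky Dx Dy.
by rewrite -kxy in e Ey; exact: (fP _ Pkx).2 _ _ Ex Ey e.
Qed.

Section discrete_subsets.
Context {R : realType} {M : Type} (d : M -> M -> R).

Definition open_for (U : set M) :=
  forall x, U x -> exists2 r, 0 < r & forall y, d x y < r -> U y.

(** Discrete in the subspace topology: the isolating radii need not be bounded
    away from zero. *)
Definition discrete_for (D : set M) :=
  forall x, D x -> exists2 r, 0 < r & forall y, D y -> d x y < r -> y = x.

Definition dense_within (U E : set M) :=
  E `<=` U /\ forall x e, U x -> 0 < e -> exists2 y, E y & d x y < e.

Definition separated_for (e : R) (D : set M) :=
  forall x y, D x -> D y -> d x y < e -> y = x.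

Lemma separated_discrete e D : 0 < e -> separated_for e D -> discrete_for D.
Proof. by move=> e0 De x Dx; exists e => // y Dy; exact: De. Qed.

Lemma discrete_bigcup (J : Type) (P : set J) (W D : J -> set M) :
  (forall j, P j -> [/\ open_for (W j), D j `<=` W j & discrete_for (D j)]) ->
  (forall i j x, P i -> P j -> W i x -> W j x -> i = j) ->
  discrete_for (\bigcup_(j in P) D j).
Proof.
move=> WD Wdisj x [j Pj Dx]; have [oW DW dD] := WD j Pj.
have [r r0 rW] := oW x (DW x Dx); have [s s0 sD] := dD x Dx.
exists (Num.min r s) => [|y [i Pi Dy]]; first by rewrite lt_min r0.
rewrite lt_min => /andP[/rW Wy xys]; apply: sD => //.
have [_ DWi _] := WD i Pi.
by rewrite (Wdisj j i y Pj Pi Wy (DWi _ Dy)).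
Qed.

Context (dM : is_metric d).

Let d_ge0 x y : 0 <= d x y. Proof. by case: dM. Qed.
Let dxx x : d x x = 0. Proof. by case: dM => _ d0 _ _; apply/d0. Qed.
Let dC x y : d x y = d y x. Proof. by case: dM. Qed.
Let dT x y z : d x y <= d x z + d z y. Proof. by case: dM. Qed.
Let d_gt0 x y : x <> y -> 0 < d x y.
Proof.
move=> xy; rewrite lt_neqAle d_ge0 andbT eq_sym; apply/eqP.
by case: dM => _ d0 _ _ /d0.
Qed.

Lemma maximal_separated (U : set M) e : 0 < e -> exists D,
  [/\ D `<=` U, separated_for e D &
      forall x, U x -> exists2 y, D y & d x y < e].
Proof.
move=> e0; pose P (D : set M) := D `<=` U /\ separated_for e D.
have [|D [[DU De] Dmax]] := @Zorn_bigcup _ P.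
  move=> G GP Gtot; split=> [x [D GD]|x y [D GD Dx] [D' GD' D'y]].
    exact: (GP D GD).1.
  have [DD'|D'D] := Gtot _ _ GD GD'.
  - by apply: (GP D' GD').2 => //; exact: DD'.
  - by apply: (GP D GD).2 => //; exact: D'D.
exists D; split=> // x Ux; apply: contrapT => nD.
have xD y : D y -> d x y < e -> False by move=> Dy xy; apply: nD; exists y.
apply: (Dmax (D `|` [set x])).
  split=> [y Dy|Dx]; first by left.
  by apply: (xD x); [apply: Dx; right|rewrite dxx].
split=> [y [/DU|->]//|y z [Dy|->] [Dz|->]//]; first exact: De.
- by rewrite dC => /(xD _ Dy).
- by move=> /(xD _ Dz).
Qed.

Lemma dense_within_bigcup (U : set M) (S : nat -> set M) :
  (forall n, S n `<=` U) ->
  (forall n x, U x -> exists2 y, S n y & d x y < n.+1%:R^-1) ->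
  dense_within U (\bigcup_n S n).
Proof.
move=> SU Sd; split=> [x [n _ /SU]//|x e Ux e0].
have [n ne] : exists n, n.+1%:R^-1 < e.
  exists (Num.truncn e^-1); rewrite invf_plt ?posrE//.
  by rewrite truncnS_gt.
have [y Sy xy] := Sd n x Ux; exists y; first by exists n.
exact: lt_trans ne.
Qed.

(** Annuli shrinking to a non-isolated point. *)
Lemma disjoint_open_sets (V : set M) x : open_for V -> V x ->
  (forall e, 0 < e -> exists2 y, y <> x & d x y < e) ->
  exists W : nat -> set M,
    (forall n, [/\ open_for (W n), W n `<=` V & W n !=set0]) /\
    (forall m n y, W m y -> W n y -> m = n).
Proof.
move=> oV Vx acc; have [r r0 rV] := oV x Vx.
have /choice[f fP] : forall e, exists y, 0 < e -> y <> x /\ d x y < e.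
  move=> e; have [e0|e0] := boolP (0 < e); last by exists x.
  by have [y] := acc e e0; exists y.
pose rad := fix rad n := if n is m.+1 then d x (f (rad m)) / 4 else r.
have rad_gt0 n : 0 < rad n.
  elim: n => //= n IH; rewrite divr_gt0//; apply: d_gt0 => e.
  by case: (fP _ IH).1.
pose D n := d x (f (rad n)).
have D_gt0 n : 0 < D n by have := rad_gt0 n.+1; rewrite /= pmulr_lgt0.
have DS n : D n.+1 < D n / 4 by exact: (fP _ (rad_gt0 n.+1)).2.
have D_lt m n : (m < n)%N -> D n < D m / 4.
  elim: n => // n IH; rewrite ltnS leq_eqVlt => /predU1P[->//|/IH h].
  by apply: lt_trans h; apply: lt_trans (DS n) _; have := D_gt0 n; lra.
have D_ltr n : D n < r.
  case: n => [|n]; first exact: (fP _ (rad_gt0 0%N)).2.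
  apply: lt_trans (D_lt 0%N _ (ltn0Sn n)) _.
  have := D_gt0 0%N; have : D 0%N < r by exact: (fP _ (rad_gt0 0%N)).2.
  by lra.
pose W n := V `&` [set y | D n / 2 < d x y < D n * 2].
exists W; split=> [n|].
  split=> [y [Vy /andP[y1 y2]]|y []//|].
    have [s s0 sV] := oV y Vy.
    exists (Num.min s (Num.min (d x y - D n / 2) (D n * 2 - d x y))).
      by rewrite !lt_min s0 !subr_gt0 y1.
    move=> z; rewrite !lt_min => /and3P[/sV Vz z1 z2]; split=> //=.
    have := dT x y z; have := dT x z y; rewrite (dC z y).
    by move=> t1 t2; apply/andP; split; lra.
  exists (f (rad n)); split=> /=; first exact/rV/D_ltr.
  by rewrite -/(D n); have := D_gt0 n => h; apply/andP; split; lra.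
have Wlt m n y : (m < n)%N -> W m y -> W n y -> False.
  move=> /D_lt h [_ /andP[a b]] [_ /andP[a' b']]; move: h a b a' b' => /=; lra.
move=> m n y Wm Wn; have [mn|nm|//] := ltngtP m n.
- by case: (Wlt m n y).
- by case: (Wlt n m y).
Qed.

(** The set [E] bounds the density character of [U] from above, so that it is
    reached by the cardinality of a discrete subset, without naming either
    cardinal. *)
Definition attains_density (U : set M) :=
  [/\ open_for U, U !=set0 & exists D E,
    [/\ D `<=` U, discrete_for D, dense_within U E & E #<= D]].

(** Here [V] has the same density character as each of its non-empty open
    subsets. It has a dense subset [\bigcup_n S n] with [S n] separated; if no
    [S n] is already as large as [E], each one embeds into a discrete subset of
    the n-th member of a disjoint sequence of open subsets of [V], because the
    density character of that member exceeds the cardinality of [S n]. *)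
Lemma attains_density_uncountable (V E : set M) : open_for V -> V !=set0 ->
  dense_within V E ->
  (forall W E', open_for W -> W !=set0 -> W `<=` V -> dense_within W E' ->
     E #<= E') ->
  (forall x, V x -> forall e, 0 < e -> exists2 y, y <> x & d x y < e) ->
  ~ countable E -> attains_density V.
Proof.
move=> oV V0 dE Emin acc ncE; split=> //; have [x0 Vx0] := V0.
have r0 n : 0 < n.+1%:R^-1 :> R by rewrite invr_gt0.
have /choice[S SP] := fun n => maximal_separated V (r0 n).
have dS : dense_within V (\bigcup_n S n).
  by apply: dense_within_bigcup => n; case: (SP n).
have [[n ES]|nES] := pselect (exists n, E #<= S n).
  exists (S n), E; split=> //; first by case: (SP n).
  by apply: (separated_discrete (r0 n)); case: (SP n).
have [W [WP Wdisj]] := disjoint_open_sets oV Vx0 (acc x0 Vx0).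
have /choice[T TP] : forall n, exists T,
    [/\ T `<=` W n, discrete_for T & S n #<= T].
  move=> n; have [oW WV W0] := WP n.
  have /choice[B BP] := fun m => maximal_separated (W n) (r0 m).
  have [[m SB]|nSB] := pselect (exists m, S n #<= B m).
    exists (B m); split=> //; first by case: (BP m).
    by apply: (separated_discrete (r0 m)); case: (BP m).
  (* Otherwise [W n] has a dense subset of cardinality at most [S n * nat]. *)
  exfalso; have BS m : B m #<= S n.
    by have [] := card_le_total (B m) (S n) => // SB; case: nSB; exists m.
  have EB : E #<= \bigcup_m B m.
    by apply: (Emin (W n)) => //; apply: dense_within_bigcup => m; case: (BP m).
  have ESn := card_le_trans EB (card_bigcup_nat_le BS).
  have [finS|infS] := pselect (finite_set (S n)).
    apply: ncE; apply: sub_countable ESn _.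
    by apply: countableX => //; exact: finite_set_countable.
  by apply: nES; exists n; exact: card_le_trans ESn (infinite_card_mul_nat infS).
exists (\bigcup_n T n), (\bigcup_n S n); split=> //.
- by move=> x [n _ Tx]; have [_ WV _] := WP n; have [TW _ _] := TP n; apply/WV/TW.
- apply: (@discrete_bigcup _ _ W) => [n _|m n x _ _]; last exact: Wdisj.
  by have [oW _ _] := WP n; have [TW dT' _] := TP n.
- apply: card_bigcup_le => [n _|m n x _ _ Tm Tn]; first by case: (TP n).
  by apply: (Wdisj m n x); [case: (TP m) => + _ _|case: (TP n) => + _ _]; exact.
Qed.

(** Among the non-empty open subsets of [U], one of least density character has
    the same density character as each of its own. *)
Lemma open_attains_density (U : set M) : open_for U -> U !=set0 ->
  exists2 V, V `<=` U & attains_density V.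
Proof.
move=> oU U0; have [x0 Ux0] := U0.
pose dens (E : set M) := exists V,
  [/\ open_for V, V !=set0, V `<=` U & dense_within V E].
have [|E [V [oV V0 VU dE]] Emin] := min_card x0 (E := dens).
  by exists U, U; split=> //; split=> // x e Ux e0; exists x; rewrite ?dxx.
have {}Emin W E' : open_for W -> W !=set0 -> W `<=` V -> dense_within W E' ->
    E #<= E'.
  by move=> oW W0 WV dE'; apply: Emin; exists W; split=> // x /WV/VU.
have [acc|/existsNP[x /not_implyP[Vx /existsNP[e /not_implyP[e0 nacc]]]]] :=
    pselect (forall x, V x -> forall e, 0 < e -> exists2 y, y <> x & d x y < e).
  exists V => //; have [cE|ncE] := pselect (countable E); last first.
    exact: attains_density_uncountable Emin acc ncE.
  have [x Vx] := V0; have [W [WP Wdisj]] := disjoint_open_sets oV Vx (acc x Vx).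
  have /choice[w wP] : forall n, exists y, W n y by move=> n; case: (WP n).
  split=> //; exists (\bigcup_n [set w n]), E; split=> //.
  - by move=> _ [n _ ->]; have [_ WV _] := WP n; apply/WV/wP.
  - apply: (@discrete_bigcup _ _ W) => [n _|m n y _ _]; last exact: Wdisj.
    by case: (WP n) => oW _ _; split=> // _ ->//; exists 1 => // _ ->.
  - apply: card_le_trans cE _.
    apply: (@fun_card_le _ _ w) => [n _|m n _ _ e]; first by exists n.
    by apply: (Wdisj m n (w m)) => //; rewrite e.
have ox : forall y, d x y < e -> y = x.
  by move=> y xy; apply: contrapT => yx; apply: nacc; exists y.
exists [set x] => [_ ->|]; first exact: VU.
split; [|by exists x|].
  by move=> _ ->; exists e.
exists [set x], [set x]; split=> //.
- by move=> _ ->; exists e => // y ->.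
- by split=> // _ r -> r0; exists x; rewrite ?dxx.
Qed.

(** A metric space contains a discrete subset of cardinality at least its
    density character, even when the latter is singular: a maximal disjoint
    family of open sets that attain their density has a dense union, over which
    the discrete and the dense subsets can be glued. *)
Lemma exists_discrete_dense : exists D E : set M,
  [/\ discrete_for D, dense_for d E & E #<= D].
Proof.
pose P (G : set (set M)) := (forall U, G U -> attains_density U) /\
  (forall U V x, G U -> G V -> U x -> V x -> U = V).
have [|G [[Gatt Gdisj] Gmax]] := @Zorn_bigcup _ P.
  move=> C CP Ctot; split=> [U [D CD]|U V x [D CD DU] [D' CD' D'V]].
    exact: (CP D CD).1.
  have [DD'|D'D] := Ctot _ _ CD CD'.
  - by apply: (CP D' CD').2 => //; exact: DD'.
  - by apply: (CP D CD).2 => //; exact: D'D.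
have /choice[DE DEP] : forall U : set M, exists DE : set M * set M, G U ->
    [/\ DE.1 `<=` U, discrete_for DE.1, dense_within U DE.2 & DE.2 #<= DE.1].
  move=> U; have [GU|nGU] := pselect (G U); last by exists (set0, set0).
  by have [_ _ [D [E DE]]] := Gatt U GU; exists (D, E).
exists (\bigcup_(U in G) (DE U).1), (\bigcup_(U in G) (DE U).2); split.
- apply: (@discrete_bigcup _ _ id) => [U GU|U V x GU GV]; last exact: Gdisj.
  by have [oU _ _] := Gatt U GU; have [] := DEP U GU.
- move=> x e e0; apply: contrapT => nE.
  (* A ball that misses the dense sets misses every member of the family. *)
  pose B := [set y | d x y < e].
  have oB : open_for B.
    move=> y xy; exists (e - d x y); first by rewrite subr_gt0.
    by move=> z yz; rewrite /B/=; have := dT x z y; move: xy yz => /=; lra.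
  have [|V VB gV] := open_attains_density oB; first by exists x; rewrite /B/= dxx.
  have BG U y : G U -> U y -> B y -> False.
    move=> GU Uy By; have [r r0 rB] := oB y By.
    have [_ _ [_ dE] _] := DEP U GU; have [z Ez yz] := dE y r Uy r0.
    by apply: nE; exists z; [exists U|exact: rB].
  have [_ [v Vv] _] := gV.
  apply: (Gmax (G `|` [set V])).
    split=> [U GU|GV]; first by left.
    by apply: (BG V v) => //; [apply: GV; right|exact: VB].
  split=> [U [/Gatt//|->//]|U W y [GU|->] [GW|->]//]; first exact: Gdisj.
  + by move=> Uy /VB By; case: (BG U y).
  + by move=> /VB By Wy; case: (BG W y).
- apply: card_bigcup_le => [U GU|U V x GU GV Ux Vx]; first by case: (DEP U GU).
  by apply: (Gdisj U V x) => //;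
    [case: (DEP U GU)|case: (DEP V GV)] => + _ _ _; exact.
Qed.

End discrete_subsets.

(** * Bump functions *)

Section bumps.
Context {R : realType} {M : Type} (d : M -> M -> R).

(** The non-linear data behind a complemented copy of [l_p(I)]: the molecule of
    the pair [(x i, y i)] is detected by the bump [u i] and by no other one. *)
Record bump_system (c : R) (I : Type) (x y : I -> M) (u : I -> M -> R) : Prop :=
  BumpSystem {
  bump_ge0 : forall i z, 0 <= u i z ;
  bump_disjoint : forall i j z, u i z <> 0 -> u j z <> 0 -> i = j ;
  bump_lip : forall i z w, `|u i z - u i w| <= d z w ;
  bump_center : forall i, 0 < u i (x i) ;
  bump_exit : forall i j, u j (y i) = 0 ;
  bump_slope : forall i, d (x i) (y i) <= c * u i (x i) }.

(** If [J] is maximal among the subsets of [A] disjoint from their image under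
    [y], then [A] is covered by [J], by [y @` J] and by the points that [y]
    maps into [J]; the last ones, outside [J], form again such a subset. *)
Lemma card_free_subset (S : Type) (X : set S) (A : set M) (y : M -> M) :
  infinite_set X -> X #<= A -> (forall x, A x -> y x <> x) ->
  exists J, [/\ J `<=` A, X #<= J & forall x z, J x -> J z -> y x <> z].
Proof.
move=> infX XA yx; pose P (J : set M) :=
  J `<=` A /\ forall x z, J x -> J z -> y x <> z.
have [|J [[JA Jy] Jmax]] := @Zorn_bigcup _ P.
  move=> G GP Gtot; split=> [x [D GD]|x z [D GD Dx] [D' GD' D'z]].
    exact: (GP D GD).1.
  have [DD'|D'D] := Gtot _ _ GD GD'.
  - by apply: (GP D' GD').2 => //; exact: DD'.
  - by apply: (GP D GD).2 => //; exact: D'D.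
pose K := [set x | A x /\ ~ J x /\ J (y x)].
have cover : A `<=` (J `|` y @` J) `|` K.
  move=> x Ax; apply: contrapT => nx.
  have nJx : ~ J x by move=> ?; apply: nx; left; left.
  have nyx z : J z -> y z <> x by move=> ? ?; apply: nx; left; right; exists z.
  have nJy : ~ J (y x) by move=> ?; apply: nx; right.
  apply: (Jmax (J `|` [set x])).
    by split=> [z Jz|Jx]; [left|apply: nJx; apply: Jx; right].
  split=> [z [/JA|->]//|z w [Jz|->] [Jw|->]].
  - exact: Jy.
  - exact: nyx.
  - by move=> e; apply: nJy; rewrite e.
  - exact: yx.
have := card_le_trans XA (subset_card_le cover).
move=> /(infinite_card_setU infX)[/(infinite_card_setU infX)[XJ|XJ]|XK].
- by exists J.
- by exists J; split=> //; exact: card_le_trans XJ (card_image_le _ _).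
- exists K; split=> // [x []//|x z [_ [_ Jyx]] [_ [nJz _]] e].
  by apply: nJz; rewrite -e.
Qed.

Lemma isolated_nearest x z c : isolated_for d x -> z <> x -> 1 < c ->
  exists ry : R * M, [/\ 0 < ry.1, forall w, w <> x -> ry.1 <= d x w,
    ry.2 <> x & d x ry.2 <= c * ry.1].
Proof.
rewrite /isolated_for; set A := [set _ | _ in _]; move=> A0 zx c1.
have Ale w : w <> x -> (ereal_inf A <= (d x w)%:E)%E.
  by move=> wx; apply: ereal_inf_lbound; exists w.
have Afin : ereal_inf A \is a fin_num.
  by rewrite gt0_fin_numE// (le_lt_trans (Ale z zx))// ltry.
set r := fine (ereal_inf A); have rE : ereal_inf A = r%:E by rewrite fineK.
have r0 : 0 < r by move: A0; rewrite rE lte_fin.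
have : (ereal_inf A < (c * r)%:E)%E by rewrite rE lte_fin ltr_pMl.
move=> /ereal_inf_lt[_ [y yx <-]]; rewrite lte_fin => xy.
exists (r, y); split=> //=; last exact: ltW.
by move=> w /Ale; rewrite rE lee_fin.
Qed.

Section symmetric.
Hypotheses (d_ge0 : forall x y, 0 <= d x y) (dC : forall x y, d x y = d y x).
Hypotheses (d0 : forall x y, d x y = 0 <-> x = y).

Lemma dense_infinite (D : set M) : infinite_set [set: M] -> dense_for d D ->
  infinite_set D.
Proof.
move=> infM dD finD.
have [x nDx] : exists x, ~ D x.
  by apply/existsNP => DT; apply: infM; apply: sub_finite_set finD => x _.
have /finite_seqP[s sE] := finite_image (d x) finD.
have [e e0 es] : exists2 e : R, 0 < e & forall t, t \in s -> e <= t.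
  have : forall t, t \in s -> 0 < t.
    move=> t ts; have : [set` s] t by [].
    rewrite -sE => -[y Dy <-]; rewrite lt_neqAle d_ge0 andbT eq_sym.
    by apply/eqP => /d0 xy; apply: nDx; rewrite xy.
  elim: s {sE} => [_|t s IH ts]; first by exists 1.
  have [|e e0 es] := IH; first by move=> v vs; apply: ts; rewrite inE vs orbT.
  exists (Num.min t e) => [|v]; first by rewrite lt_min e0 ts ?mem_head.
  by rewrite inE ge_min => /predU1P[->|/es->]; rewrite ?lexx ?orbT.
have [y Dy] := dD x e e0; apply/negP; rewrite -leNgt; apply: es.
by have : (d x @` D) (d x y) by [exists y]; rewrite sE.
Qed.

(** An almost nearest point of an isolated point may be the centre of another
    bump, hence the restriction to a subset given by [card_free_subset]. *)
Lemma isolated_bumps (I : Type) c : infinite_set [set: M] -> 1 < c ->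
  infinite_set [set: I] -> [set: I] #<= [set x | isolated_for d x] ->
  exists x y u, @bump_system c I x y u.
Proof.
move=> infM c1 infI IA; have [m0 _] := infinite_setN0 infM.
have other x : exists z : M, z <> x.
  apply: contrapT => nz; apply: infM; apply: sub_finite_set (finite_set1 x).
  by move=> z _; apply: contrapT => zx; apply: nz; exists z.
have /choice[ry ryP] : forall x, exists ry : R * M, isolated_for d x ->
    [/\ 0 < ry.1, forall w, w <> x -> ry.1 <= d x w,
      ry.2 <> x & d x ry.2 <= c * ry.1].
  move=> x; have [ix|nix] := pselect (isolated_for d x); last by exists (0, x).
  by have [z zx] := other x; have [ry] := isolated_nearest ix zx c1; exists ry.
have [|J [JA IJ Jy]] := card_free_subset (y := fun x => (ry x).2) infI IA.
  by move=> x /ryP[].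
have [g [gJ ginj]] := card_le_fun m0 IJ.
have gP i := ryP (g i) (JA _ (gJ i Logic.I)).
pose u i z := if pselect (z = g i) then (ry (g i)).1 else 0.
have uE i : u i (g i) = (ry (g i)).1 by rewrite /u; case: pselect.
have u0 i z : z <> g i -> u i z = 0 by rewrite /u; case: pselect.
have un0 i z : u i z <> 0 -> z = g i by move=> h; apply: contrapT => /u0/h.
exists g, (fun i => (ry (g i)).2), u; split.
- by move=> i z; rewrite /u; case: pselect => [zi|//]; apply: ltW; case: (gP i).
- by move=> i j z /un0 zi /un0 zj; apply: ginj => //; rewrite -zi -zj.
- move=> i z w; have [r0 rle _ _] := gP i.
  have [->|zi] := pselect (z = g i); have [->|wi] := pselect (w = g i).
  + by rewrite subrr normr0.
  + by rewrite uE u0// subr0 gtr0_norm//; exact: rle.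
  + by rewrite uE u0// sub0r normrN gtr0_norm// dC; exact: rle.
  + by rewrite !u0// subrr normr0.
- by move=> i; rewrite uE; case: (gP i).
- by move=> i j; apply: u0; apply: Jy; exact: gJ.
- by move=> i; rewrite uE; case: (gP i).
Qed.

End symmetric.

(** The half radii of isolation make the balls disjoint, and each bump together
    with its exit point stays inside its own ball. *)
Lemma accumulation_bumps (I : Type) c (D : set M) : is_metric d -> 1 < c ->
  [set: I] !=set0 -> discrete_for d D -> (forall x, D x -> ~ isolated_for d x) ->
  [set: I] #<= D -> exists x y u, @bump_system c I x y u.
Proof.
move=> [d_ge0 d0 dC dT] c1 [i0 _] dD Dacc ID.
have /choice[sy syP] : forall x, exists sy : R * M, D x ->
    [/\ forall z, D z -> d x z < sy.1 -> z = x, 0 < d x sy.2 &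
      d x sy.2 < sy.1 / 2].
  move=> x; have [Dx|nDx] := pselect (D x); last by exists (0, x).
  have [s s0 sD] := dD x Dx.
  apply: contrapT => nsy; apply: (Dacc x Dx).
  apply: (@lt_le_trans _ _ (s / 2)%:E); first by rewrite lte_fin divr_gt0.
  apply: le_ereal_inf_tmp => _ [y /= yx <-]; rewrite lee_fin leNgt; apply/negP => ys.
  apply: nsy; exists (s, y); split=> //=; rewrite lt_neqAle d_ge0 andbT eq_sym.
  by apply/eqP => /d0 xy; apply: yx.
have [m0 _] : D !=set0.
  apply/set0P/eqP => DE; move: ID; rewrite DE => /card_le0P IE.
  by have : [set: I] i0 by []; rewrite IE.
have [g [gD ginj]] := card_le_fun m0 ID.
have gP i := syP (g i) (gD i Logic.I).
pose y i := (sy (g i)).2; pose s i := (sy (g i)).1.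
have close i j z : d (g i) z < s i / 2 -> d (g j) z < s j / 2 -> i = j.
  move=> iz jz; have t : d (g i) (g j) < s i / 2 + s j / 2.
    by apply: le_lt_trans (dT _ _ z) _; rewrite (dC z) ltrD.
  have [ij|ji] := leP (s i) (s j).
    have [h _ _] := gP j; apply: ginj => //; apply: h; first exact: gD.
    by rewrite dC -/(s j); lra.
  have [h _ _] := gP i; apply/esym/ginj => //; apply: h; first exact: gD.
  by rewrite -/(s i); lra.
have ys i : d (g i) (y i) < s i / 2 by case: (gP i).
have y0 i : 0 < d (g i) (y i) by case: (gP i).
pose u i z := Num.max 0 (d (g i) (y i) - d (g i) z).
have un0 i z : u i z <> 0 -> d (g i) z < d (g i) (y i).
  move=> h; rewrite ltNge; apply/negP => le; apply: h.
  by apply/max_idPl; rewrite subr_le0.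
have uc i : u i (g i) = d (g i) (y i).
  by rewrite /u (_ : d (g i) (g i) = 0) ?subr0; [apply/max_idPr/ltW|apply/d0].
exists g, y, u; split.
- by move=> i z; rewrite /u le_max lexx.
- move=> i j z /un0 iz /un0 jz; apply: (close i j z).
  + exact: lt_trans iz (ys i).
  + exact: lt_trans jz (ys j).
- move=> i z w; rewrite /u.
  have := dT (g i) z w; have := dT (g i) w z; rewrite (dC w z).
  rewrite ler_norml /Num.max; do 2 case: ifPn; rewrite -?leNgt => *;
    apply/andP; split; lra.
- by move=> i; rewrite uc.
- move=> i j; apply: contrapT => h; have := un0 _ _ h.
  have [<-|ij] := pselect (i = j); first by rewrite ltxx.
  by move=> /lt_trans/(_ (ys j))/(close i j _ (ys i)).
- by move=> i; rewrite uc ler_peMl ?d_ge0 ?ltW.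
Qed.

Lemma dens_infinite (p : R) (I : choiceType) : infinite_set [set: M] ->
  is_metric d \/ is_pmetric p d -> has_card_dens d I -> infinite_set [set: I].
Proof.
move=> infM dP [[D dD ID] _] finI.
have [d_ge0 d0] : (forall x y, 0 <= d x y) /\ (forall x y, d x y = 0 <-> x = y).
  by case: dP => -[].
apply: (dense_infinite d_ge0 d0 infM dD).
by rewrite -(eq_finite_set ID).
Qed.

Lemma exists_bumps (p c : R) (I : choiceType) : infinite_set [set: M] ->
  has_card_dens d I -> infinite_set [set: I] -> 1 < c ->
  is_metric d \/
    (is_pmetric p d /\ [set: I] #<= [set x | isolated_for d x]) ->
  exists x y u, @bump_system c I x y u.
Proof.
move=> infM [_ Imin] infI c1 dP.
have [d_ge0 dC] : (forall x y, 0 <= d x y) /\ (forall x y, d x y = d y x).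
  by case: dP => [[]//|[[]]].
have isolated := isolated_bumps d_ge0 dC infM c1 infI.
case: dP => [dM|[_ Iiso]]; last exact: isolated.
have [D [E [dD dE ED]]] := exists_discrete_dense dM.
have := card_le_trans (Imin E dE) ED.
have -> : D = (D `&` isolated_for d) `|` (D `\` isolated_for d).
  by rewrite setUIDK.
move=> /(infinite_card_setU infI)[ID|ID].
  by apply: isolated; apply: card_le_trans ID (subset_card_le _) => x [].
apply: accumulation_bumps ID => //; first exact: infinite_setN0.
  move=> x [Dx _]; have [r r0 rD] := dD x Dx.
  by exists r => // y [Dy _]; exact: rD.
by move=> x [].
Qed.

End bumps.

(** * [p]-normed spaces *)

Section pnormed.
Context {R : realType} {p : R} (p0 : 0 < p).

Lemma powR_le_inv (x y : R) : 0 <= y -> x `^ p <= y `^ p -> x <= y.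
Proof.
move=> y0; apply: contraTT; rewrite -!ltNge => yx.
by apply: gt0_ltr_powR; rewrite // nnegrE // ltW// (le_lt_trans y0).
Qed.

Lemma powR_le (x y : R) : 0 <= x -> x <= y -> x `^ p <= y `^ p.
Proof.
move=> x0 xy; apply: ge0_ler_powR; rewrite ?nnegrE ?(ltW p0)//.
exact: le_trans xy.
Qed.

Lemma powRK (x : R) : 0 <= x -> (x `^ p^-1) `^ p = x.
Proof. by move=> x0; rewrite -powRrM mulVf ?gt_eqF// powRr1. Qed.

Context {X : pNormedType p}.
Implicit Types x y z : X.

Lemma pnorm0 : pnorm (0 : X) = 0.
Proof. by rewrite -(scale0r 0) pnormZ normr0 mul0r. Qed.

Lemma pnormN x : pnorm (- x) = pnorm x.
Proof. by rewrite -scaleN1r pnormZ normrN1 mul1r. Qed.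

Lemma pnormBC x y : pnorm (x - y) = pnorm (y - x).
Proof. by rewrite -pnormN opprB. Qed.

Lemma ler_pnormB z x y :
  pnorm (x - y) `^ p <= pnorm (x - z) `^ p + pnorm (z - y) `^ p.
Proof. by rewrite (le_trans _ (ler_pnormD _ _))// addrA subrK. Qed.

Lemma ler_pnorm_sum (J : Type) (s : seq J) (F : J -> X) :
  pnorm (\sum_(j <- s) F j) `^ p <= \sum_(j <- s) pnorm (F j) `^ p.
Proof.
elim/big_ind2 : _ => [|a v b w av bw|//].
  by rewrite pnorm0 powR0 ?gt_eqF.
by rewrite (le_trans (ler_pnormD _ _))// lerD.
Qed.

Lemma pnormP (u : nat -> X) l :
  pnorm (u n - l) @[n --> \oo] --> (0 : R) <->
  forall e, 0 < e -> exists N, forall n, (N <= n)%N -> pnorm (u n - l) < e.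
Proof.
split=> [/cvgr0Pnorm_lt h e /h[N _ hN]|h].
  by exists N => n /hN /=; rewrite ger0_norm// pnorm_ge0.
apply/cvgr0Pnorm_lt => e /h[N hN]; exists N => // n /hN.
by rewrite /= ger0_norm// pnorm_ge0.
Qed.

Lemma pnorm_cauchyP (u : nat -> X) :
  (forall e, 0 < e -> \forall m & n \near \oo, pnorm (u m - u n) < e) <->
  forall e, 0 < e -> exists N, forall m n, (N <= m)%N -> (N <= n)%N ->
    pnorm (u m - u n) < e.
Proof.
split=> [h e /h[[A B] [[N1 _ N1A] [N2 _ N2B]] AB]|h e /h[N hN]].
  exists (maxn N1 N2) => m n; rewrite !geq_max => /andP[m1 m2] /andP[n1 n2].
  by apply: (AB (m, n)); split; [exact: N1A|exact: N2B].
exists ([set n | (N <= n)%N], [set n | (N <= n)%N]).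
  by split; exists N.
by move=> [m n] [/= Nm Nn]; exact: hN.
Qed.

End pnormed.

Lemma opnorm_le (R : realType) (p : R) (X Y : pNormedType p) (T : X -> Y) K :
  0 <= K -> (forall x, pnorm (T x) <= K * pnorm x) -> opnorm T <= K.
Proof.
move=> K0 TK; apply: ge_sup.
  by exists (pnorm (T 0)), 0; rewrite //= pnorm0.
move=> _ [x /= x1 <-]; rewrite (le_trans (TK x))//.
by rewrite -[leRHS]mulr1 ler_wpM2l.
Qed.

Lemma opnorm_ge0 (R : realType) (p : R) (X Y : pNormedType p) (T : X -> Y) :
  0 <= opnorm T.
Proof.
rewrite /opnorm; set A := [set _ | _ in _].
have [supA|nA] := pselect (has_sup A); last by rewrite sup_out.
have [r Ar] := supA.1; apply: (@le_trans _ _ r).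
  by case: Ar => x _ <-; exact: pnorm_ge0.
by apply: ub_le_sup => //; exact: supA.2.
Qed.

(** * The spaces [l_p(I)] *)

Section lp_space.
Context {R : realType} {p : R} (hp : 0 < p <= 1) {I : choiceType}.
Implicit Types (a b : lp hp I) (A B : {fset I}).

Let p0 : 0 < p. Proof. by case/andP: hp. Qed.

Lemma lp_sumE a : lp_sum p a = (pnorm a `^ p)%:E.
Proof.
have s0 : (0 <= lp_sum p a)%E.
  by apply: esum_ge0 => i _; rewrite lee_fin powR_ge0.
have sfin : lp_sum p a \is a fin_num by rewrite ge0_fin_numE//; exact: (valP a).
by rewrite /pnorm/= /lp_norm (powRK p0) ?fineK// fine_ge0.
Qed.

Lemma lp_sum_le (f : I -> R) (K : R) :
  (forall A, \sum_(i <- A) `|f i| `^ p <= K) -> (lp_sum p f <= K%:E)%E.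
Proof.
move=> fK; apply: ge_ereal_sup => _ [A [finA _] <-].
by rewrite fsbig_finite//= sumEFin lee_fin.
Qed.

Lemma ler_sum_lp a A : \sum_(i <- A) `|a i| `^ p <= pnorm a `^ p.
Proof.
rewrite -lee_fin -lp_sumE -sumEFin; apply: ereal_sup_ubound.
exists [set` A]; first by split.
by rewrite fsbig_finite//= set_fsetK.
Qed.

Lemma lp_tail a e : 0 < e ->
  exists A, pnorm a `^ p - \sum_(i <- A) `|a i| `^ p < e.
Proof.
move=> e0; have : ((pnorm a `^ p - e)%:E < lp_sum p a)%E.
  by rewrite lp_sumE lte_fin ltrBlDr ltrDl.
move=> /ereal_sup_gt[_ [A [finA _] <-]].
rewrite fsbig_finite//= sumEFin lte_fin => h.
by exists (fset_set A); rewrite ltrBlDr addrC -ltrBlDr.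
Qed.

Lemma ler_coord_lp a i : `|a i| <= pnorm a.
Proof.
apply: (powR_le_inv p0); first exact: pnorm_ge0.
by have := ler_sum_lp a [fset i]%fset; rewrite big_seq_fset1.
Qed.

Lemma lp_ext a b : (forall i, a i = b i) -> a = b.
Proof. by move=> ab; apply/val_inj/funext. Qed.

Lemma lp_coordB a b i : lp_fun (a - b) i = a i - b i.
Proof. by []. Qed.

Lemma lp_coordZD (k : R) a b i : lp_fun (k *: a + b) i = k * a i + b i.
Proof. by []. Qed.

Lemma lp_sum_single (i : I) (c : R) :
  (lp_sum p (fun j => if j == i then c else 0%R) <= (`|c| `^ p)%:E)%E.
Proof.
apply: lp_sum_le => A.
rewrite (eq_bigr (fun j => if j == i then `|c| `^ p else 0)); last first.
  by move=> j _; case: ifP => // _; rewrite normr0 powR0 ?gt_eqF.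
rewrite -big_mkcond/= big_const_seq iter_addr_0.
rewrite (count_uniq_mem _ (fset_uniq A)) -mulr_natl ler_piMl ?powR_ge0//.
by rewrite lern1 leq_b1.
Qed.

Lemma lp_single_subproof (i : I) (c : R) :
  (fun j : I => if j == i then c else 0) \in lp_pred hp.
Proof. exact: le_lt_trans (lp_sum_single i c) (ltry _). Qed.

Definition lp_single i (c : R) : lp hp I := Lp (lp_single_subproof i c).

Lemma lp_singleE i c j : lp_single i c j = if j == i then c else 0.
Proof. by []. Qed.

Lemma lp_single0 i : lp_single i 0 = 0.
Proof. by apply: lp_ext => j; rewrite lp_singleE if_same. Qed.

Lemma lp_singleB i c e : lp_single i c - lp_single i e = lp_single i (c - e).
Proof.
apply: lp_ext => j; rewrite lp_coordB !lp_singleE.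
by case: eqP; rewrite ?subr0.
Qed.

Lemma lp_singleZ i k c : k *: lp_single i c = lp_single i (k * c).
Proof.
apply: lp_ext => j.
rewrite -[k *: _]addr0 lp_coordZD addr0 !lp_singleE.
by case: eqP; rewrite ?mulr0.
Qed.

Lemma pnorm_lp_single i c : pnorm (lp_single i c) <= `|c|.
Proof.
apply: (powR_le_inv p0); first exact: normr_ge0.
by rewrite -lee_fin -lp_sumE; exact: lp_sum_single.
Qed.

(** Coordinatewise limits are limits for the [p]-norm because each finite
    partial sum of [|u n i - u m i| ^ p] passes to the limit in [m]. *)
Lemma lp_complete (u : nat -> lp hp I) :
  (forall e, 0 < e -> \forall m & n \near \oo, pnorm (u m - u n) < e) ->
  exists l : lp hp I, pnorm (u n - l) @[n --> \oo] --> (0 : R).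
Proof.
move=> /pnorm_cauchyP cu.
have ccv i : cvgn (fun n => u n i).
  apply/cauchy_cvgP/cauchy_exP => e e0; have [N hN] := cu e e0.
  exists (u N i); exists N => // n /= Nn; rewrite -ball_normE /ball_/= -lp_coordB.
  by apply: le_lt_trans (ler_coord_lp _ _) _; exact: hN.
pose l i := limn (fun n => u n i).
have lP i : u n i - l i @[n --> \oo] --> (0 : R).
  by apply/subr_cvg0; exact: ccv.
have tail e : 0 < e -> exists N, forall n, (N <= n)%N ->
    (lp_sum p (fun i => u n i - l i)%R <= (e `^ p)%:E)%E.
  move=> e0; have [N hN] := cu e e0; exists N => n Nn; apply: lp_sum_le => A.
  pose g m := e `^ p + \sum_(i <- A) `|u m i - l i| `^ p.
  have term_cv i : `|u m i - l i| `^ p @[m --> \oo] --> (0 : R).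
    apply/cvgr0Pnorm_lt => eta eta0.
    have r0 : 0 < eta `^ p^-1 by rewrite powR_gt0.
    have /cvgr0Pnorm_lt/(_ _ r0) := lP i.
    apply: filterS => m /= h; rewrite ger0_norm ?powR_ge0//.
    rewrite -[ltRHS](powRK p0) ?(ltW eta0)//.
    by apply: gt0_ltr_powR; rewrite // nnegrE ?powR_ge0.
  have gcv : g m @[m --> \oo] --> e `^ p + \sum_(i <- A) (0 : R).
    apply: cvgD; first exact: cvg_cst.
    exact: (@cvg_big R I +%R 0 xpredT (@add_continuous R) nat \oo A
      (fun i m => `|u m i - l i| `^ p) (fun=> 0) _ (fun i _ => term_cv i)).
  rewrite big1// addr0 in gcv.
  apply: (cvgr_to_ge gcv); exists N => // m /= Nm; rewrite /g.
  have : \sum_(i <- A) `|u n i - u m i| `^ p <= e `^ p.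
    apply: le_trans (ler_sum_lp (u n - u m) A) _; apply: (powR_le p0) => //.
      exact: pnorm_ge0.
    by apply: ltW; exact: hN.
  move=> h; apply: le_trans (lerD h (lexx _)); rewrite -big_split/=.
  apply: ler_sum => i _.
  apply: le_trans (ler_powRD hp _ _) => //; apply: (powR_le p0) => //.
  by rewrite (le_trans _ (ler_normD _ _))// addrA subrK.
have [N /(_ _ (leqnn N)) lN] := tail 1 ltr01.
have lin : (fun i => u N i - l i) \in lp_pred hp.
  by apply: le_lt_trans lN (ltry _).
pose b : lp hp I := Lp lin.
have bE n i : (u n - (u N - b)) i = u n i - l i.
  by rewrite !lp_coordB /=; lra.
exists (u N - b); apply/pnormP => e e0.
have e20 : 0 < e / 2 by rewrite divr_gt0.
have [K hK] := tail _ e20; exists K => n Kn.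
apply: (@le_lt_trans _ _ (e / 2)); last by lra.
apply: (powR_le_inv p0); first exact: ltW.
rewrite -lee_fin -lp_sumE.
by rewrite (_ : lp_fun _ = fun i => u n i - l i) ?hK//; apply/funext => i; exact: bE.
Qed.

HB.instance Definition _ := PNormed_isComplete.Build R p (lp hp I) lp_complete.

End lp_space.

(** * Synthesis of sums in a [p]-Banach space *)

Lemma perm_fsubset (I : choiceType) (A B : {fset I}) : (A `<=` B)%fset ->
  perm_eq B (A ++ [seq i <- B | i \notin A]).
Proof.
move=> AB; apply: uniq_perm; first exact: fset_uniq.
  rewrite cat_uniq fset_uniq filter_uniq ?fset_uniq// andbT/=.
  by apply/hasPn => i; rewrite mem_filter => /andP[].
move=> i; rewrite mem_cat mem_filter.
have [iA|] := boolP (i \in A); last by [].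
by rewrite (fsubsetP AB).
Qed.

Section synthesis.
Context {R : realType} {p : R} (hp : 0 < p <= 1) {I : choiceType}.
Context {X : pBanachType p} (m : I -> X) (c : R).
Hypotheses (c0 : 0 <= c) (mc : forall i, pnorm (m i) <= c).
Implicit Types (a b : lp hp I) (A B : {fset I}).

Let p0 : 0 < p. Proof. by case/andP: hp. Qed.

Let psum a A := \sum_(i <- A) a i *: m i.
Let tail a A := pnorm a `^ p - \sum_(i <- A) `|a i| `^ p.

Let tail_ge0 a A : 0 <= tail a A.
Proof. by rewrite subr_ge0 ler_sum_lp. Qed.

Let psum_incr a A B : (A `<=` B)%fset ->
  tail a B <= tail a A /\
  pnorm (psum a B - psum a A) `^ p <= c `^ p * (tail a A - tail a B).
Proof.
move=> /perm_fsubset AB; rewrite /tail /psum !(perm_big _ AB)/= !big_cat/=.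
set s := [seq _ <- _ | _]; split.
  by rewrite lerB// lerDl sumr_ge0// => i _; exact: powR_ge0.
rewrite addrAC subrr add0r (le_trans (ler_pnorm_sum p0 _ _))//.
rewrite [X in c `^ p * X](_ : _ = \sum_(i <- s) `|a i| `^ p); last by lra.
rewrite mulr_sumr; apply: ler_sum => i _.
rewrite pnormZ powRM ?pnorm_ge0// mulrC ler_wpM2r ?powR_ge0//.
exact: (powR_le p0) (pnorm_ge0 _) (mc i).
Qed.

Let tail_small a e : 0 < e -> exists A, tail a A < e.
Proof. exact: lp_tail. Qed.

(** Any two partial sums are compared through the union of their supports. *)
Let psum_close a A B :
  pnorm (psum a A - psum a B) `^ p <= c `^ p * (tail a A + tail a B).
Proof.
have [tA uA] := psum_incr a (fsubsetUl A B).
have [tB uB] := psum_incr a (fsubsetUr A B).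
apply: le_trans (ler_pnormB (psum a (A `|` B)%fset) _ _) _.
rewrite (pnormBC (psum a A)); apply: le_trans (lerD uA uB) _.
rewrite -mulrDr ler_wpM2l ?powR_ge0//.
by have := tail_ge0 a (A `|` B)%fset; lra.
Qed.

(** The bound by the tail singles out the sum and already contains both the
    norm estimate ([A] empty) and the convergence of the net of partial sums. *)
Let sum_exists a : exists v, forall A,
  pnorm (v - psum a A) `^ p <= c `^ p * tail a A.
Proof.
have r0 n : 0 < n.+1%:R^-1 :> R by rewrite invr_gt0.
have /choice[A AP] := fun n => tail_small a (r0 n).
have small e : 0 < e -> exists N, forall n, (N <= n)%N ->
    c `^ p * tail a (A n) < e.
  move=> e0; have k0 : 0 < c `^ p + 1 by rewrite ltr_wpDl ?powR_ge0.
  exists (Num.truncn ((c `^ p + 1) / e)) => n Nn.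
  apply: (@le_lt_trans _ _ ((c `^ p + 1) * tail a (A n))).
    by rewrite ler_wpM2r ?tail_ge0// lerDl.
  apply: (@lt_le_trans _ _ ((c `^ p + 1) * n.+1%:R^-1)); first by rewrite ltr_pM2l.
  rewrite ler_pdivrMr ?ltr0n// mulrC -ler_pdivrMr// ltW//.
  by apply: lt_le_trans (truncnS_gt _) _; rewrite ler_nat.
have [|v /(pnormP)vP] := @pnorm_complete _ _ _ (fun n => psum a (A n)).
  apply/pnorm_cauchyP => e e0.
  have e20 : 0 < e `^ p / 2 by rewrite divr_gt0// powR_gt0.
  have [N hN] := small _ e20; exists N => k n Nk Nn.
  rewrite ltNge; apply/negP => /(powR_le p0 (ltW e0)); apply/negP; rewrite -ltNge.
  apply: le_lt_trans (psum_close _ _ _) _; rewrite mulrDr.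
  by have := hN _ Nk; have := hN _ Nn; lra.
exists v => B; apply/ler_addgt0Pr => e e0.
have e20 : 0 < e / 2 by rewrite divr_gt0.
have [N hN] := small _ e20.
have r20 : 0 < (e / 2) `^ p^-1 by rewrite powR_gt0.
have [K hK] := vP _ r20.
pose n := maxn N K.
have h1 := hN n (leq_maxl _ _); have h2 := ltW (hK n (leq_maxr _ _)).
have {}h2 := powR_le p0 (pnorm_ge0 _) h2; rewrite (powRK p0 (ltW e20)) in h2.
apply: le_trans (ler_pnormB (psum a (A n)) _ _) _.
rewrite pnormBC; apply: le_trans (lerD h2 (psum_close _ _ _)) _.
by rewrite mulrDr; lra.
Qed.

Definition synth a : X := projT1 (cid (sum_exists a)).

Let synthP a A : pnorm (synth a - psum a A) `^ p <= c `^ p * tail a A.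
Proof. exact: (projT2 (cid (sum_exists a))). Qed.

Lemma synth_bounded a : pnorm (synth a) <= c * pnorm a.
Proof.
apply: (powR_le_inv p0); first by rewrite mulr_ge0 ?pnorm_ge0.
have := synthP a fset0; rewrite /psum /tail !big_seq_fset0 !subr0.
by rewrite powRM ?pnorm_ge0.
Qed.

Lemma synth_cvg a e : 0 < e -> exists A, forall B, (A `<=` B)%fset ->
  pnorm (synth a - \sum_(i <- B) a i *: m i) < e.
Proof.
move=> e0; have k0 : 0 < c `^ p + 1 by rewrite ltr_wpDl ?powR_ge0.
have [|A At] := @tail_small a (e `^ p / (c `^ p + 1)).
  by rewrite divr_gt0// powR_gt0.
exists A => B AB; rewrite ltNge; apply/negP => /(powR_le p0 (ltW e0)).
apply/negP; rewrite -ltNge; apply: le_lt_trans (synthP a B) _.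
have [tBA _] := psum_incr a AB.
move: At; rewrite ltr_pdivlMr// mulrC; apply: le_lt_trans.
apply: (@le_trans _ _ (c `^ p * tail a A)); first by rewrite ler_wpM2l ?powR_ge0.
by rewrite ler_wpM2r ?tail_ge0// lerDl.
Qed.

Let pnorm_eq0 (x : X) : (forall e, 0 < e -> pnorm x `^ p <= e) -> x = 0.
Proof.
move=> h; apply: pnorm0_eq0; apply: (@powR_eq0_eq0 _ _ p); apply/eqP.
by rewrite eq_le powR_ge0 andbT; apply/ler_addgt0Pr => e /h; rewrite add0r.
Qed.

Lemma synth_linear : linear synth.
Proof.
move=> k a b; apply/eqP; rewrite -subr_eq0; apply/eqP/pnorm_eq0 => e e0.
have k10 : 0 < `|k| + 1 by rewrite ltr_wpDl.
set r := (e / 3) `^ p^-1; have r0 : 0 < r by rewrite powR_gt0// divr_gt0.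
have rE : r `^ p = e / 3 by rewrite powRK// ltW// divr_gt0.
have rk0 : 0 < r / (`|k| + 1) by rewrite divr_gt0.
have [A1 h1] := synth_cvg (k *: a + b) r0.
have [A2 h2] := synth_cvg a rk0; have [A3 h3] := synth_cvg b r0.
pose B := (A1 `|` (A2 `|` A3))%fset.
have {}h1 : pnorm (synth (k *: a + b) - psum (k *: a + b) B) `^ p <= e / 3.
  rewrite -rE; apply: (powR_le p0) (pnorm_ge0 _) (ltW (h1 _ _)).
  exact: fsubsetUl.
have {}h2 : pnorm (k *: (psum a B - synth a)) `^ p <= e / 3.
  rewrite -rE; apply: (powR_le p0) (pnorm_ge0 _) _.
  rewrite pnormZ pnormBC (@le_trans _ _ ((`|k| + 1) * (r / (`|k| + 1))))//.
    rewrite ler_pM// ?pnorm_ge0 ?lerDl// ltW// h2//.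
    by rewrite (fsubset_trans _ (fsubsetUr _ _))// fsubsetUl.
  by rewrite mulrC divfK// gt_eqF.
have {}h3 : pnorm (psum b B - synth b) `^ p <= e / 3.
  rewrite -rE pnormBC; apply: (powR_le p0) (pnorm_ge0 _) (ltW (h3 _ _)).
  by rewrite (fsubset_trans _ (fsubsetUr _ _))// fsubsetUr.
have psumD : psum (k *: a + b) B = k *: psum a B + psum b B.
  rewrite /psum scaler_sumr -big_split/=; apply: eq_bigr => i _.
  by rewrite scalerA -scalerDl.
rewrite (_ : _ - _ = (synth (k *: a + b) - psum (k *: a + b) B) +
    (k *: (psum a B - synth a) + (psum b B - synth b))); last first.
  rewrite psumD scalerBr opprD [_ - _ + (_ - _)]addrACA -opprD addrA.
  by rewrite subrK.
apply: le_trans (ler_pnormD _ _) _.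
apply: (@le_trans _ _ (e / 3 + (e / 3 + e / 3))); last by lra.
by apply: lerD => //; apply: le_trans (ler_pnormD _ _) _; exact: lerD.
Qed.

HB.instance Definition _ :=
  GRing.isLinear.Build R (lp hp I) X *:%R synth synth_linear.

(** The images under [T] of the partial sums converge, and their [j]-th
    coordinate is [a j] as soon as [j] belongs to the index set. *)
Lemma synthK (T : {linear X -> lp hp I}) : bounded_op T ->
  (forall i, T (m i) = lp_single hp i 1) -> cancel synth T.
Proof.
move=> [K TK] Tm a; apply: lp_ext => j; apply/eqP; rewrite -subr_eq0 -normr_eq0.
rewrite eq_le normr_ge0 andbT; apply/ler_addgt0Pr => e e0; rewrite add0r.
have k0 : 0 < `|K| + 1 by rewrite ltr_wpDl.
have [|A hA] := @synth_cvg a (e / (`|K| + 1)); first by rewrite divr_gt0.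
have {hA} := hA (j |` A)%fset (fsubsetUr _ _); set B := (j |` A)%fset => hB.
have TB : T (\sum_(i <- B) a i *: m i) j = a j.
  rewrite linear_sum/=.
  have -> : \sum_(i <- B) T (a i *: m i) = \sum_(i <- B) lp_single hp i (a i).
    by apply: eq_bigr => i _; rewrite linearZ/= Tm lp_singleZ mulr1.
  have coord_sum (s : seq I) : lp_fun (\sum_(i <- s) lp_single hp i (a i)) j =
      \sum_(i <- s) (if j == i then a i else 0).
    by elim/big_ind2 : _ => // x r y t <- <-.
  rewrite coord_sum -big_mkcond/= (eq_bigr (fun=> a j)); last by move=> i /eqP->.
  rewrite big_const_seq iter_addr_0 (eq_count (eq_sym j)).
  by rewrite (count_uniq_mem _ (fset_uniq B)) fset1U1.
rewrite -TB -lp_coordB -linearB; apply: le_trans (ler_coord_lp _ _) _.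
apply: le_trans (TK _) _; apply: le_trans (ler_wpM2r (pnorm_ge0 _) (ler_norm _)) _.
move: (ltW hB); rewrite ler_pdivlMr// mulrC; apply: le_trans.
by rewrite ler_wpM2r ?pnorm_ge0// lerDl.
Qed.

End synthesis.

(** * The complemented copy of [l_p] *)

Section bump_map.
Context {R : realType} {p : R} (hp : 0 < p <= 1) {I : choiceType}.
Context {M : Type} {d : M -> M -> R} {c : R} {x y : I -> M} {u : I -> M -> R}.
Hypothesis xyu : bump_system d c x y u.

Let p0 : 0 < p. Proof. by case/andP: hp. Qed.

Lemma bump_map_exists : [set: I] !=set0 -> exists k : M -> I,
  forall z i, i <> k z -> u i z = 0.
Proof.
move=> [i0 _].
suff /choice[k kP] : forall z, exists k : I, forall i, i <> k -> u i z = 0.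
  by exists k.
move=> z; have [[k uk]|nex] := pselect (exists k, u k z <> 0).
  exists k => i ik; apply: contrapT => ui; apply: ik.
  exact: (bump_disjoint xyu ui uk).
by exists i0 => i _; apply: contrapT => ui; apply: nex; exists i.
Qed.

Variable k : M -> I.
Hypothesis kP : forall z i, i <> k z -> u i z = 0.

Definition bump_map z : lp hp I := lp_single hp (k z) (u (k z) z).

(** For [z] and [w] in the supports of distinct bumps, each bump vanishes at the
    other point, so that both values are at most [d z w]: hence the factor 2 for
    the [p]-th powers. *)
Lemma bump_map_lip z w :
  pnorm (bump_map z - bump_map w) <= 2 `^ p^-1 * d z w.
Proof.
have d0 : 0 <= d z w by apply: le_trans (bump_lip xyu (k z) z w).
apply: (powR_le_inv p0); first by rewrite mulr_ge0 ?powR_ge0.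
rewrite powRM ?powR_ge0// powRK// mulr_natl mulr2n.
have [kzw|/eqP kzw] := eqVneq (k z) (k w).
  rewrite /bump_map -kzw lp_singleB; apply: (@le_trans _ _ (d z w `^ p)).
    apply: (powR_le p0) (pnorm_ge0 _) _.
    exact: le_trans (pnorm_lp_single _ _ _) (bump_lip xyu _ _ _).
  by rewrite lerDl powR_ge0.
apply: le_trans (ler_pnormD _ _) _; rewrite pnormN.
apply: lerD; apply: (powR_le p0) (pnorm_ge0 _) _;
  apply: le_trans (pnorm_lp_single _ _ _) _.
- by rewrite -[u _ _]subr0 -(kP kzw); exact: bump_lip xyu _ _ _.
- rewrite -normrN -sub0r -(kP (nesym kzw)); exact: bump_lip xyu _ _ _.
Qed.

Lemma bump_map_center i : bump_map (x i) = lp_single hp i (u i (x i)).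
Proof.
suff kx : k (x i) = i by rewrite /bump_map kx.
apply: contrapT => /nesym/kP ui; have := bump_center xyu i.
by rewrite ui ltxx.
Qed.

Lemma bump_map_exit i : bump_map (y i) = 0.
Proof. by rewrite /bump_map (bump_exit xyu) lp_single0. Qed.

End bump_map.

Theorem theorem2p1 (R : realType) (p : R) (hp : 0 < p <= 1)
    (M : Type) (d : M -> M -> R) (I : choiceType)
    (hM : infinite_set [set: M]) (hI : has_card_dens d I)
    (hd : is_metric d \/
          (is_pmetric p d /\ [set: I] #<= [set x | isolated_for d x]))
    (x0 : M) (F : pBanachType p) (delta : M -> F)
    (hF : is_lipschitz_free d x0 delta)
    (C : R) (hC : 2 `^ p^-1 < C) :
  complemented C (lp hp I : pNormedType p) F.
Proof.
have q0 : 0 < 2 `^ p^-1 :> R by rewrite powR_gt0.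
(* The factor [2 `^ p^-1] of [C] goes to the projection, the rest to the
   molecules. *)
pose c := C / 2 `^ p^-1.
have c1 : 1 < c by rewrite /c ltr_pdivlMr// mul1r.
have c0 : 0 <= c by rewrite ltW// (lt_trans _ c1).
have infI : infinite_set [set: I].
  by apply: (dens_infinite (p := p) hM _ hI); case: hd => [|[]]; [left|right].
have [x [y [u xyu]]] := exists_bumps hM hI infI c1 hd.
have [k kP] := bump_map_exists xyu (infinite_setN0 infI).
have [d_ge0 d0] : (forall x y, 0 <= d x y) /\ (forall x y, d x y = 0 <-> x = y).
  by case: hd => [[? ? ? ?]|[[? ? ? ?] _]].
have [deltaE delta0 univ] := hF.
pose m i := (u i (x i))^-1 *: (delta (x i) - delta (y i)).
have mc i : pnorm (m i) <= c.
  have ui := bump_center xyu i.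
  rewrite pnormZ deltaE gtr0_norm ?invr_gt0// mulrC ler_pdivrMr//.
  exact: bump_slope xyu i.
pose f z : lp hp I := bump_map hp (u := u) k z - bump_map hp (u := u) k x0.
have f_lip z w : pnorm (f z - f w) <= 2 `^ p^-1 * d z w.
  rewrite /f opprB addrA subrK; exact: (bump_map_lip hp xyu kP z w).
have [||T [Tbd TE Tnorm _]] := univ (lp hp I : pBanachType p) f.
- by exists (2 `^ p^-1).
- by rewrite /f subrr.
have Tm i : T (m i) = lp_single hp i 1.
  have ui := bump_center xyu i.
  rewrite /m linearZ/= linearB/= !TE /f opprB addrA subrK.
  rewrite (bump_map_center hp xyu kP) (bump_map_exit hp xyu k) subr0 lp_singleZ.
  by rewrite mulVf// gt_eqF.
exists (synth mc : {linear lp hp I -> F}), T; split=> //.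
- by exists c => a; exact: synth_bounded.
- exact: synthK.
rewrite -[C](divfK (lt0r_neq0 q0)) -/c.
apply: ler_pM; rewrite ?opnorm_ge0//.
  by apply: opnorm_le => // a; exact: synth_bounded.
rewrite Tnorm /lip_const; set A := [set _ | _].
have [->|A0] := eqVneq A set0; first by rewrite sup0 ltW.
apply: ge_sup; first exact/set0P.
move=> _ [z [w [zw ->]]].
rewrite ler_pdivrMr ?f_lip// lt_neqAle d_ge0 andbT eq_sym.
by apply/eqP => /d0.
Qed.
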